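(* Let $s,t$ be integers with $t\neq 0$. Then there do not exist a positive integer $l$ and polynomials $G_0(X),G_1(X),\ldots,G_l(X)\in\mathbb Q[X]$ such that \[ P_n(s,t)=G_0(n)+\sum_{j=1}^l G_j(n)\,P_{n-j}(s,t) \] for all sufficiently large positive integers $n$, where $P_n(s,t)$ denotes the $n$-th Lucas atom evaluated at $(s,t)$.
   Context: Lucas atoms: for $n\ge 1$ let $\Phi_n(\alpha,\beta)=\prod_{1\le j\le n,\ \gcd(j,n)=1}(\alpha-\omega^j\beta)$, with $\omega$ a primitive $n$-th root of unity (the homogenization of the $n$-th cyclotomic polynomial). Put $P_1(s,t)=1$, and for $n\ge 2$ let $P_n(s,t)\in\mathbb Z[s,t]$ be the unique polynomial with $P_n(\alpha+\beta,-\alpha\beta)=\Phi_n(\alpha,\beta)$ as polynomials in the variables $\alpha,\beta$. *)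

(* Defs.v *)
From HB Require Import structures.
From mathcomp Require Import all_boot all_order all_fingroup all_algebra all_field.
From mathcomp Require Import mpoly.

Set Implicit Arguments.
Unset Strict Implicit.
Unset Printing Implicit Defensive.

Import GRing.Theory Num.Theory.
Local Open Scope ring_scope.

Local Notation X0 := ('X_(@ord0 1)).
Local Notation X1 := ('X_(@ord_max 1)).

(* For w a primitive n-th root of unity this is Phi_n(alpha, beta), with alpha
   and beta the two variables X0 and X1.                                      *)
Definition cyclotomic_form (n : nat) (w : algC) : {mpoly algC[2]} :=
  \prod_(1 <= j < n.+1 | coprime j n) (X0 - w ^+ j *: X1).

(* P(s, t) |-> P(alpha + beta, - alpha * beta), with s and t the variables of P. *)
Definition subst_sum_oppprod (P : {mpoly int[2]}) : {mpoly algC[2]} :=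
  map_mpoly intr P \mPo [tuple X0 + X1; - (X0 * X1)].

Section Homogenization.
Variable R : comNzRingType.
Implicit Types (p : {poly R}) (z : R).

(* The homogenization in degree d of p, provided size p <= d.+1.              *)
Definition homog2 d p : {mpoly R[2]} :=
  \sum_(i < d.+1) p`_i *: (X0 ^+ i * X1 ^+ (d - i)).

Lemma homog2_mulXsubC d p z : (size p <= d.+1)%N ->
  homog2 d.+1 (('X - z%:P) * p) = (X0 - z *: X1) * homog2 d p.
Proof.
move=> sp; rewrite /homog2 mulrBl.
rewrite (eq_bigr (fun i : 'I_d.+2 =>
    ('X * p)`_i *: (X0 ^+ i * X1 ^+ (d.+1 - i))
    - (z * p`_i) *: (X0 ^+ i * X1 ^+ (d.+1 - i)))); last first.
  by move=> i _; rewrite coefB coefCM scalerBl.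
rewrite sumrB [RHS]mulrBl; congr (_ - _).
  rewrite big_ord_recl coefXM /= scale0r add0r mulr_sumr.
  apply: eq_bigr => i _; rewrite coefXM /= -scalerAr mulrA -exprS.
  by rewrite /bump /= add1n subSS.
rewrite big_ord_recr /= nth_default // mulr0 scale0r addr0 mulr_sumr.
apply: eq_bigr => i _; rewrite -scalerAl -scalerAr scalerA.
by rewrite mulrCA -exprS subSn // -ltnS.
Qed.

Lemma homog2_prod (s : seq R) :
  homog2 (size s) (\prod_(z <- s) ('X - z%:P)) = \prod_(z <- s) (X0 - z *: X1).
Proof.
elim: s => [|z s IHs] /=.
  by rewrite !big_nil /homog2 big_ord_recl big_ord0 coefC eqxx scale1r mulr1 addr0.
by rewrite !big_cons homog2_mulXsubC ?IHs // size_prod_XsubC.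
Qed.

End Homogenization.

Lemma map_mpoly_intr_inj n :
  injective (map_mpoly (intr : int -> algC) : {mpoly int[n]} -> {mpoly algC[n]}).
Proof.
move=> p q /mpolyP eq_pq; apply/mpolyP => m; have := eq_pq m.
by rewrite !mcoeff_map_mpoly => /intr_inj.
Qed.

Lemma map_homog2 d (p : {poly int}) :
  map_mpoly intr (homog2 d p) = homog2 d (map_poly intr p) :> {mpoly algC[2]}.
Proof.
rewrite rmorph_sum; apply: eq_bigr => i _ /=.
by rewrite map_mpolyZ rmorphM !rmorphXn /= !map_mpolyX coef_map.
Qed.

Section CyclotomicForm.
Variable n : nat.
Hypothesis n_gt1 : (1 < n)%N.

Lemma cyclotomic_formE w :
  cyclotomic_form n w = \prod_(1 <= j < n | coprime j n) (X0 - w ^+ j *: X1).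
Proof.
rewrite /cyclotomic_form big_mkcond big_nat_recr ?(ltnW n_gt1) //= -big_mkcond.
by rewrite /coprime gcdnn gtn_eqF //= mulr1.
Qed.

Lemma cyclotomic_form_int w : n.-primitive_root w ->
  cyclotomic_form n w = map_mpoly intr (homog2 (totient n) 'Phi_n).
Proof.
move=> prim_w; rewrite map_homog2 (Cintr_Cyclotomic prim_w).
pose s := [seq w ^+ j | j <- [seq j <- iota 0 n | coprime j n]].
have -> : cyclotomic w n = \prod_(z <- s) ('X - z%:P).
  rewrite big_map big_filter /cyclotomic.
  by rewrite -(big_mkord (coprime^~ n) (fun k => 'X - (w ^+ k)%:P)) /index_iota subn0.
have -> : totient n = size s.
  rewrite size_map size_filter totient_count_coprime -sum1_count.
  by rewrite -big_mkcond /index_iota subn0; apply: eq_bigl => k; rewrite coprime_sym.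
rewrite homog2_prod cyclotomic_formE big_map big_filter.
have -> : iota 0 n = index_iota 0 n by rewrite /index_iota subn0.
rewrite [RHS]big_mkcond big_ltn ?(ltnW n_gt1) //= -big_mkcond.
by rewrite /coprime gcd0n gtn_eqF //= mul1r.
Qed.

Lemma cyclotomic_form_swap w : n.-primitive_root w ->
  \prod_(1 <= j < n | coprime j n) (X1 - w ^+ j *: X0) = cyclotomic_form n w.
Proof.
move=> prim_w; have w_neq0 : w != 0.
  by rewrite -unitfE -(unitrX_pos _ (ltnW n_gt1)) (prim_expr_order prim_w) unitr1.
pose c := \prod_(1 <= j < n | coprime j n) (- w ^+ j).
have swapE : \prod_(1 <= j < n | coprime j n) (X1 - w ^+ j *: X0)
    = c *: cyclotomic_form n w.
  rewrite cyclotomic_formE [in RHS]big_nat_rev /= -mul_mpolyC /c rmorph_prod /=.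
  rewrite [X in _ * X]big_nat_cond.
  rewrite [X in _ * X](eq_bigl (fun j => ((1 <= j < n) && coprime j n)%N)); last first.
    move=> j; case jP: (1 <= j < n)%N => //=; case/andP: jP => _ j_ltn.
    rewrite add1n subSS /coprime -{2 3}(subnK (ltnW j_ltn)).
    by rewrite gcdnDl gcdnDr gcdnC.
  rewrite -big_nat_cond -big_split /= [LHS]big_nat_cond [RHS]big_nat_cond.
  apply: eq_bigr => j /andP[/andP[j_gt0 j_ltn] _]; rewrite add1n subSS.
  rewrite mul_mpolyC scalerBr scalerA mulNr -exprD subnKC ?(ltnW j_ltn) //.
  by rewrite (prim_expr_order prim_w) !scaleNr scale1r opprK addrC.
suff c1 : c = 1 by rewrite swapE c1 scale1r.
have ev_neq0 : (cyclotomic_form n w).@[fun=> 1] != 0.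
  rewrite cyclotomic_formE rmorph_prod /= big_nat_cond prodf_seq_neq0.
  apply/allP => j _; apply/implyP => /andP[/andP[j_gt0 j_ltn] _].
  rewrite mevalB mevalZ !mevalXU mulr1 subr_eq0 eq_sym.
  by rewrite -(prim_order_dvd prim_w) gtnNdvd.
apply: (mulIf ev_neq0); rewrite mul1r -mevalZ -swapE cyclotomic_formE !rmorph_prod /=.
by apply: eq_bigr => j _; rewrite !mevalB !mevalZ !mevalXU.
Qed.

Lemma cyclotomic_form_sym w : n.-primitive_root w ->
  cyclotomic_form n w \is symmetric.
Proof.
move=> prim_w; apply/issymP => s.
have msymXU i : msym s 'X_i = 'X_(s i) :> {mpoly algC[2]}.
  by rewrite /msym mmapX mmap1U.
have ord2P (i : 'I_2) : i = ord0 \/ i = ord_max.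
  by case: i => [[|[|//]]] ?; [left|right]; apply: val_inj.
have sneq : s ord0 != s ord_max by rewrite (inj_eq perm_inj).
rewrite [X in msym s X]cyclotomic_formE rmorph_prod /=.
under eq_bigr => j _ do rewrite msymB msymZ !msymXU.
case: (ord2P (s ord0)) sneq => ->; case: (ord2P (s ord_max)) => ->; rewrite ?eqxx // => _.
  by rewrite cyclotomic_formE.
exact: cyclotomic_form_swap.
Qed.

End CyclotomicForm.

Lemma comp_mpolyA (R : comNzRingType) (n k l : nat) (p : {mpoly R[n]})
    (u : n.-tuple {mpoly R[k]}) (v : k.-tuple {mpoly R[l]}) :
  (p \mPo u) \mPo v = p \mPo [tuple tnth u i \mPo v | i < n].
Proof.
rewrite (comp_mpolyE p u) [RHS]comp_mpolyE raddf_sum /=.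
apply: eq_bigr => m _; rewrite comp_mpolyZ rmorph_prod /=; congr (_ *: _).
by apply: eq_bigr => i _; rewrite rmorphXn /= tnth_mktuple.
Qed.

Definition opp_snd (p : {mpoly int[2]}) : {mpoly int[2]} :=
  p \mPo [tuple X0; - X1].

Lemma opp_sndK : involutive opp_snd.
Proof.
move=> p; rewrite /opp_snd comp_mpolyA -[RHS]comp_mpoly_id; congr (_ \mPo _).
apply: eq_from_tnth => i; rewrite !tnth_mktuple.
by case: i => [[|[|//]]] ?; rewrite /tnth /= ?raddfN /= comp_mpolyXU /= ?opprK;
  congr mpolyX; congr mnm1; apply: val_inj.
Qed.

Lemma subst_sum_oppprodE (P : {mpoly int[2]}) :
  subst_sum_oppprod P =
  map_mpoly intr (opp_snd P \mPo [tuple mesym 2 int i.+1 | i < 2]).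
Proof.
rewrite /subst_sum_oppprod /opp_snd comp_mpolyA map_mpoly_comp; last exact: intr_inj.
congr (_ \mPo _); apply: eq_from_tnth => i; rewrite tnth_map tnth_mktuple.
have e0 : [tuple mesym 2 int i.+1 | i < 2]`_0 = X0 + X1.
  rewrite -[0%N]/(val (@ord0 1)) -tnth_nth tnth_mktuple mesym1E !big_ord_recr big_ord0 /= add0r.
  by congr (mpolyX _ (mnm1 _) + mpolyX _ (mnm1 _)); apply: val_inj.
have e1 : [tuple mesym 2 int i.+1 | i < 2]`_1 = X0 * X1.
  rewrite -[1%N]/(val (@ord_max 1)) -tnth_nth tnth_mktuple mesymnnE !big_ord_recr big_ord0 /= mul1r.
  by congr (mpolyX _ (mnm1 _) * mpolyX _ (mnm1 _)); apply: val_inj.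
case: i => [[|[|//]]] ?; rewrite /tnth /= ?raddfN /= comp_mpolyXU ?e0 ?e1.
  by rewrite rmorphD /= !map_mpolyX.
by rewrite rmorphM /= !map_mpolyX.
Qed.

Lemma subst_sum_oppprod_inj : injective subst_sum_oppprod.
Proof.
move=> P Q; rewrite !subst_sum_oppprodE => /map_mpoly_intr_inj.
by move/msym_fundamental_un/(congr1 opp_snd); rewrite !opp_sndK.
Qed.

Definition std_prim_root (n : nat) : algC :=
  sval (C_prim_root_exists (ltn0Sn n.-1)).

Lemma std_prim_rootP n : (0 < n)%N -> n.-primitive_root (std_prim_root n).
Proof. by case: n => // n _; exact: (svalP (C_prim_root_exists (ltn0Sn n))). Qed.

(* The choice of the primitive root is immaterial: see lucas_atomP. The value
   P = 1 at n = 0 is a junk value.                                            *)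
Definition is_lucas_atom (n : nat) (P : {mpoly int[2]}) : bool :=
  if (n <= 1)%N then P == 1
  else subst_sum_oppprod P == cyclotomic_form n (std_prim_root n).

Lemma lucas_atom_exists (n : nat) : exists P, is_lucas_atom n P.
Proof.
rewrite /is_lucas_atom; case: leqP => [_ | n_gt1]; first by exists 1.
have prim_w := std_prim_rootP (ltnW n_gt1); have := cyclotomic_form_sym n_gt1 prim_w.
rewrite (cyclotomic_form_int n_gt1 prim_w); set F := homog2 _ _ => symF.
have {}symF : F \is symmetric.
  apply/issymP => s; apply: map_mpoly_intr_inj.
  rewrite -[RHS](issymP _ symF s); apply/mpolyP => m.
  by rewrite mcoeff_map_mpoly !mcoeff_sym mcoeff_map_mpoly.
have [t [tF _]] := sym_fundamental symF.
by exists (opp_snd t); rewrite subst_sum_oppprodE opp_sndK tF.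
Qed.

(* For 1 < n the polynomial chosen is the only solution: see lucas_atom_unique. *)
Definition lucas_atom (n : nat) : {mpoly int[2]} := xchoose (lucas_atom_exists n).

Definition lucas_atom_at (n : nat) (s t : int) : int :=
  (lucas_atom n).@[tnth [tuple s; t]].

Lemma lucas_atom1 : lucas_atom 1 = 1.
Proof. by apply/eqP; apply: (xchooseP (lucas_atom_exists 1)). Qed.

Lemma lucas_atomP (n : nat) (w : algC) : (1 < n)%N -> n.-primitive_root w ->
  subst_sum_oppprod (lucas_atom n) = cyclotomic_form n w.
Proof.
move=> n_gt1 prim_w; have := xchooseP (lucas_atom_exists n).
rewrite -/(lucas_atom n) /is_lucas_atom leqNgt n_gt1 /= => /eqP ->.
by rewrite !cyclotomic_form_int // std_prim_rootP // ltnW.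
Qed.

Lemma lucas_atom_unique (n : nat) (w : algC) (P : {mpoly int[2]}) :
  (1 < n)%N -> n.-primitive_root w ->
  subst_sum_oppprod P = cyclotomic_form n w -> P = lucas_atom n.
Proof.
move=> n_gt1 prim_w PE; apply: subst_sum_oppprod_inj.
by rewrite PE (lucas_atomP n_gt1 prim_w).
Qed.

(* Main.v *)
Require Import Defs.
From mathcomp Require Import all_boot all_order all_algebra.
From mathcomp Require Import all_field mpoly.

(* Reduce modulo a prime p dividing neither t nor any denominator of the G_j.
   The state (n mod p, P_(n-1), ..., P_(n-l)) takes finitely many values and
   determines P_n, so the sequence P_n mod p is eventually periodic.  In a
   finite field of characteristic p write s = a + b and t = - a b with a, b
   nonzero, and let m be the order of a / b.  Up to a unit P_n is Phi_n (a / b),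
   and for n > 1 it vanishes at n = p ^ k * m for k > 0, and only if
   n = p ^ k * m for some k.  An infinite set with such gaps is not eventually
   periodic.                                                                  *)

Set Implicit Arguments.
Unset Strict Implicit.
Unset Printing Implicit Defensive.

Import GRing.Theory Num.Theory.
Local Open Scope ring_scope.

(** * Eventual periodicity over a finite ring *)

Lemma prec_eventually_periodic (F : finNzRingType) (l N : nat)
    (g : nat -> {poly F}) (u : nat -> F) :
  (forall n, (N <= n)%N ->
     u n = (g 0%N).[n%:R] + \sum_(1 <= j < l.+1) (g j).[n%:R] * u (n - j)%N) ->
  exists2 T, (0 < T)%N & exists M, forall n, (M <= n)%N -> u (n + T)%N = u n.
Proof.
move=> rec_u.
pose state i : F * {ffun 'I_l -> F} :=
  ((N + i)%:R, [ffun j : 'I_l => u (N + i + j)%N]).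
have [i [j [lt_ij eq_ij]]] : exists i j, (i < j)%N /\ state i = state j.
  pose f (i : 'I_(#|{: F * {ffun 'I_l -> F}}|.+1)) := state i.
  have [/injectiveP inj_f|/injectivePn[i [j ne_ij eq_f]]] := boolP (injectiveb f).
    by have := leq_card f inj_f; rewrite card_ord ltnn.
  have [lt_ij|lt_ji|/val_inj eq_ij] := ltngtP i j; last by rewrite eq_ij eqxx in ne_ij.
    by exists i, j.
  by exists j, i.
case: eq_ij => eq_char /ffunP eq_win.
have eq_u k : u (N + i + k)%N = u (N + j + k)%N.
  elim/ltn_ind: k => k IHk; have [lt_kl|le_lk] := ltnP k l.
    by have := eq_win (Ordinal lt_kl); rewrite !ffunE.
  rewrite !rec_u -?addnA ?leq_addr // !addnA.
  have -> : (N + i + k)%:R = (N + j + k)%:R :> F by rewrite natrD eq_char -natrD.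
  (* Since [a <= l <= k], the subtraction does not truncate and the index stays at or after the
     start of the window, where the induction hypothesis applies. *)
  congr (_ + _); apply: eq_big_nat => a /andP[a_gt0 lt_al].
  rewrite -!addnBA ?(leq_trans _ le_lk) // IHk //.
  by rewrite ltn_subrL a_gt0 (leq_trans a_gt0) // (leq_trans _ le_lk).
exists (j - i)%N; first by rewrite subn_gt0.
exists (N + i)%N => n le_n; rewrite -(subnKC le_n) eq_u; congr u.
by rewrite -addnA [X in (_ + X)%N]addnC addnA -(addnA N) subnKC // ltnW.
Qed.

(** * Lucas atoms as values of cyclotomic polynomials *)

Lemma mmap_comp_mpoly (n k : nat) (R S : comNzRingType) (f : {rmorphism R -> S})
    (h : 'I_k -> S) (lq : n.-tuple {mpoly R[k]}) (p : {mpoly R[n]}) :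
  mmap f h (p \mPo lq) = mmap f (fun i => mmap f h (tnth lq i)) p.
Proof.
rewrite comp_mpolyE raddf_sum /= /mmap; apply: eq_bigr => m _.
rewrite -/(mmap f h _) mmapZ rmorph_prod; congr (_ * _).
by apply: eq_bigr => i _; rewrite rmorphXn.
Qed.

Lemma mmap_meval (n : nat) (R S : comNzRingType) (f : {rmorphism R -> S})
    (v : 'I_n -> R) (p : {mpoly R[n]}) : mmap f (f \o v) p = f p.@[v].
Proof.
rewrite mevalE rmorph_sum; apply: eq_bigr => m _.
by rewrite rmorphM rmorph_prod; congr (_ * _); apply: eq_bigr => i _; rewrite rmorphXn.
Qed.

(** Injectivity of the coefficient map from the integers to [algC] brings the defining identity down
    to integer coefficients. It can then be evaluated in any commutative ring, in particular in
    characteristic p. *)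
Lemma lucas_atom_homog2 (n : nat) : (1 < n)%N ->
  lucas_atom n \mPo
    [tuple 'X_(@ord0 1) + 'X_(@ord_max 1); - ('X_(@ord0 1) * 'X_(@ord_max 1))]
  = homog2 (totient n) 'Phi_n.
Proof.
move=> n_gt1; have prim_w := std_prim_rootP (ltnW n_gt1).
apply: map_mpoly_intr_inj; rewrite -(cyclotomic_form_int n_gt1 prim_w).
rewrite -(lucas_atomP n_gt1 prim_w) map_mpoly_comp; last exact: intr_inj.
congr (_ \mPo _); apply: eq_from_tnth => i; rewrite tnth_map.
case: i => [[|[|//]]] ?; rewrite /tnth /=.
  by rewrite rmorphD /= !map_mpolyX.
by rewrite rmorphN rmorphM /= !map_mpolyX.
Qed.

Lemma lucas_atom_at_Cyclotomic (F : fieldType) (s t : int) (a b : F) (n : nat) :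
    a + b = s%:~R -> a * b = - t%:~R -> b != 0 -> (1 < n)%N ->
  (lucas_atom_at n s t)%:~R = b ^+ totient n * (map_poly intr 'Phi_n).[a / b].
Proof.
move=> sE tE b_neq0 n_gt1; pose h := tnth [tuple a; b].
have := congr1 (mmap (intr : int -> F) h) (lucas_atom_homog2 n_gt1).
rewrite mmap_comp_mpoly => atomE; rewrite /lucas_atom_at -mmap_meval.
transitivity (mmap intr h (homog2 (totient n) 'Phi_n)).
  rewrite -atomE; apply: eq_bigr => m _; congr (_ * _); apply: eq_bigr => i _.
  congr (_ ^+ _); case: i => [[|[|//]]] ?; rewrite /tnth /= ?rmorphN ?rmorphD ?rmorphM /=.
    by rewrite !mmapX !mmap1U sE.
  by rewrite !mmapX !mmap1U tE opprK.
rewrite raddf_sum /= (@horner_coef_wide _ (totient n).+1) ?mulr_sumr; last first.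
  by rewrite (leq_trans (size_poly _ _)) // size_Cyclotomic.
apply: eq_bigr => i _; rewrite mmapZ rmorphM !rmorphXn /= !mmapX !mmap1U coef_map.
have -> : h ord0 = a by []; have -> : h ord_max = b by [].
rewrite [RHS]mulrCA; congr (_ * _); have le_in : (i <= totient n)%N by rewrite -ltnS.
(* Exactly [b ^+ i] is split off, to cancel the denominator of [(a / b) ^+ i]. *)
have -> : b ^+ totient n = b ^+ (totient n - i) * b ^+ i by rewrite -exprD subnK.
by rewrite -mulrA -exprMn mulrCA divff // mulr1 mulrC.
Qed.

(** * Cyclotomic polynomials and splitting in characteristic p *)

(** Both sides are the quotient of X^(eq) - 1 by X^e - 1: one from the cyclotomic factorizations,
    the other from the geometric series. Unlike a ratio of values, the identity remains usable at a
    point z with z^e = 1. *)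
Lemma prod_Cyclotomic_compl (e q : nat) : (0 < e)%N -> (0 < q)%N ->
  \prod_(d <- divisors (e * q) | ~~ (d %| e)%N) 'Phi_d = \sum_(i < q) 'X^(e * i).
Proof.
move=> e_gt0 q_gt0; have eq_gt0 : (0 < e * q)%N by rewrite muln_gt0 e_gt0.
have Xe_neq0 : 'X^e - 1 != 0 :> {poly int}.
  rewrite -prod_Cyclotomic // monic_neq0 ?monic_prod // => d _.
  exact: Cyclotomic_monic.
apply: (mulfI Xe_neq0); under [X in _ = _ * X]eq_bigr do rewrite exprM.
rewrite -subrX1 -exprM -!prod_Cyclotomic // [RHS](bigID (fun d => d %| e)%N) /=.
congr (_ * _); rewrite -[in RHS]big_filter; apply: perm_big; apply: uniq_perm.
- exact: divisors_uniq.
- by rewrite filter_uniq ?divisors_uniq.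
move=> d; rewrite mem_filter -!dvdn_divisors //.
by case: (boolP (d %| e)%N) => // de; rewrite dvdn_mulr.
Qed.

(** [F] is the splitting field of X^2 - s X - t over F_p, and Vieta's formulas give the two
    relations. The roots may coincide. *)
Lemma exists_split_quadratic (p : nat) (s t : int) : prime p ->
  exists F : finFieldType, p \in [pchar F] /\
    exists a b : F, a + b = s%:~R /\ a * b = - t%:~R.
Proof.
move=> p_pr; pose Q : {poly 'F_p} := 'X^2 - s%:~R *: 'X - t%:~R%:P.
have sQ : size Q = 3.
  rewrite /Q -addrA -opprD size_polyDl ?size_polyXn // size_polyN.
  by rewrite -mul_polyC size_MXaddC; case: ifP => // _;
    exact: size_polyC_leq1.
have Q_neq0 : Q != 0 by rewrite -size_poly_eq0 sQ.
have [L [rs QE _]] := FinSplittingFieldFor Q_neq0.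
have Qmonic : map_poly (in_alg L) Q \is monic.
  rewrite map_monic monicE lead_coefE sQ /= !coefB coefXn coefZ coefX coefC /=.
  by rewrite mulr0 !subr0.
have {QE} QE : map_poly (in_alg L) Q = \prod_(z <- rs) ('X - z%:P).
  by apply/eqP; rewrite -eqp_monic ?monic_prod_XsubC.
have srs : size rs = 2.
  by have := congr1 (size \o val) QE; rewrite /= size_map_poly sQ size_prod_XsubC => -[].
exists (FinFieldExtType L); split; first by rewrite (pchar_lalg L) pchar_Fp.
case: rs srs QE => [|a [|b []]] //= _; rewrite !big_cons big_nil mulr1.
rewrite /Q !rmorphB /= map_polyXn map_polyZ map_polyX map_polyC /=.
have intA c : (c%:~R : 'F_p)%:A = c%:~R :> L by rewrite scaler_int.
rewrite !intA => QE; exists a, b; split.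
  have := congr1 (fun q : {poly L} => q`_1) QE.
  rewrite /= mulrBl !(coefB, coefXM, coefCM, coefZ, coefXn, coefX, coefC) /=.
  by rewrite mulr1 !sub0r !subr0 mulr1 -opprD => /oppr_inj ->; rewrite addrC.
have := congr1 (fun q : {poly L} => q.[0]) QE.
by rewrite /= !hornerE expr0n /= subrr sub0r mulrNN => ->.
Qed.

Lemma expr_pchar_pow_eq1 (F : fieldType) (p : nat) (x : F) (k : nat) :
  p \in [pchar F] -> x ^+ (p ^ k) = 1 -> x = 1.
Proof.
move=> pF; elim: k => // k IHk; rewrite expnSr exprM -(pFrobenius_autE pF) => xE.
by apply: IHk; apply: (fmorph_inj (pFrobenius_aut pF)); rewrite [LHS]xE rmorph1.
Qed.

Section CyclotomicRootsPchar.
Variables (F : fieldType) (p m : nat) (z : F).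
Hypotheses (pF : p \in [pchar F]) (prim_z : m.-primitive_root z).
Let Phi d : {poly F} := map_poly intr 'Phi_d.
Let p_pr : prime p := pcharf_prime pF.
Let m_gt0 : (0 < m)%N := prim_order_gt0 prim_z.

(** Every term of the geometric sum is 1 at z. The value q vanishes in [F] exactly when p divides q:
    taking q prime to p excludes roots, taking q = p produces one. *)
Lemma prod_Cyclotomic_compl_prim_root (e q : nat) : (0 < e)%N -> (0 < q)%N ->
    (m %| e)%N ->
  \prod_(d <- divisors (e * q) | ~~ (d %| e)%N) (Phi d).[z] = q%:R.
Proof.
move=> e_gt0 q_gt0 me; 
  have := congr1 (map_poly (intr : int -> F)) (prod_Cyclotomic_compl e_gt0 q_gt0).
move/(congr1 (horner^~ z)); rewrite rmorph_prod horner_prod /= => ->.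
rewrite rmorph_sum horner_sum (eq_bigr (fun=> 1)) ?sumr_const ?card_ord // => i _.
rewrite /= map_polyXn hornerXn exprM.
by move: me; rewrite (prim_order_dvd prim_z) => /eqP ->; rewrite expr1n.
Qed.

(** Write n = p^v n' with p not dividing n'. As z^n = 1 and Frobenius is injective, z^n' = 1, so n'
    = q m and n = e q with e = p^v m. If n did not divide e, the factor for d = n would make the
    product of value q vanish, although p does not divide q. *)
Lemma root_Cyclotomic_pchar (n : nat) : (0 < n)%N ->
  root (Phi n) z -> exists k, n = (p ^ k * m)%N.
Proof.
move=> n_gt0 rn.
have zn1 : z ^+ n = 1.
  have := congr1 (map_poly (intr : int -> F)) (prod_Cyclotomic n_gt0).
  move/(congr1 (horner^~ z)).
  rewrite rmorph_prod horner_prod rmorphB /= map_polyXn rmorph1 !hornerE.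
  move=> prodE; apply/eqP; rewrite -subr_eq0 -prodE prodf_seq_eq0.
  by apply/hasP; exists n; rewrite ?divisors_id.
have [n' cop_pn' nE] := pfactor_coprime p_pr n_gt0.
exists (logn p n).
have /dvdnP[q n'E] : (m %| n')%N.
  rewrite (prim_order_dvd prim_z); apply/eqP/(@expr_pchar_pow_eq1 _ p _ (logn p n) pF).
  by rewrite -exprM -nE.
set e := (p ^ logn p n * m)%N.
have q_neq0 : q%:R != 0 :> F.
  rewrite -(dvdn_pcharf pF); apply: contraL cop_pn' => pq.
  by rewrite prime_coprime // negbK n'E dvdn_mulr.
have q_gt0 : (0 < q)%N by case: q q_neq0 {n'E} => //; rewrite eqxx.
have e_gt0 : (0 < e)%N by rewrite muln_gt0 expn_gt0 prime_gt0.
have {}nE : n = (e * q)%N by rewrite [LHS]nE n'E /e mulnC [(q * m)%N]mulnC mulnA.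
apply/eqP; rewrite eqn_dvd {2}nE dvdn_mulr // andbT.
apply: contraR q_neq0 => nNe.
rewrite -(prod_Cyclotomic_compl_prim_root e_gt0) ?dvdn_mull //.
by rewrite -nE prodf_seq_eq0; apply/hasP; exists n; rewrite ?divisors_id ?nNe //.
Qed.

(** With e = p^k m and q = p the product is 0, so z is a root for some d dividing p e but not e. By
    the previous lemma d = p^j m, which forces j = k + 1. *)
Lemma Cyclotomic_pchar_root (k : nat) : root (Phi (p ^ k.+1 * m)) z.
Proof.
have e_gt0 : (0 < p ^ k * m)%N by rewrite muln_gt0 expn_gt0 prime_gt0.
have nE : (p ^ k.+1 * m = p ^ k * m * p)%N by rewrite expnSr mulnAC.
have me : (m %| p ^ k * m)%N by rewrite dvdn_mull.
have /eqP := prod_Cyclotomic_compl_prim_root e_gt0 (prime_gt0 p_pr) me.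
rewrite (pcharf0 pF) -nE prodf_seq_eq0 => /hasP[d].
have n_gt0 : (0 < p ^ k.+1 * m)%N by rewrite muln_gt0 expn_gt0 prime_gt0.
rewrite -dvdn_divisors // => dn /andP[dNe rd]; have d_gt0 := dvdn_gt0 n_gt0 dn.
have [j dE] := root_Cyclotomic_pchar d_gt0 rd; move: dn dNe rd; rewrite {}dE.
rewrite !dvdn_pmul2r // !dvdn_Pexp2l ?prime_gt1 // -ltnNge => jk kj.
by rewrite (_ : j = k.+1) //; apply/eqP; rewrite eqn_leq jk kj.
Qed.

End CyclotomicRootsPchar.

Lemma exists_prim_root_order (F : finFieldType) (z : F) : z != 0 ->
  exists m, m.-primitive_root z.
Proof.
move=> z_neq0; have F_gt1 := finNzRing_gt1 F.
have F_gt0 : (0 < #|F|.-1)%N by rewrite -ltnS prednK // ltnW.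
have [|m prim_z _] := @prim_order_exists _ _ z F_gt0; last by exists m.
by apply: (mulfI z_neq0); rewrite mulr1 -exprS prednK ?expf_card // ltnW.
Qed.

(** * Clearing denominators and the contradiction *)

Lemma rat_polys_common_denom (l : nat) (G : nat -> {poly rat}) :
  exists2 D : int, D != 0 & exists H : nat -> {poly int},
    forall j, (j < l)%N -> D%:~R *: G j = map_poly intr (H j).
Proof.
elim: l => [|l [D D_neq0 [H HE]]]; first by exists 1 => //; exists (fun=> 0).
have [q [a a_neq0 GE]] := rat_poly_scale (G l).
exists (a * D); first by rewrite mulf_neq0.
exists (fun j => if j == l then D *: q else a *: H j) => j; rewrite ltnS leq_eqVlt.
have [-> _ | _ /= lt_jl] := eqVneq j l.
  rewrite GE scalerA intrM mulrAC divff ?intr_eq0 // mul1r.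
  by rewrite -!mul_polyC rmorphM /= map_polyC.
by rewrite intrM -scalerA HE // -!mul_polyC rmorphM /= map_polyC.
Qed.

Lemma horner_map_intr_nat (R : nzRingType) (q : {poly int}) (n : nat) :
  (map_poly (intr : int -> R) q).[n%:R] = (q.[n%:R])%:~R.
Proof. by rewrite -[n%:R](rmorph_nat (intr : int -> R)) horner_map. Qed.

Theorem theorem24 (s t : int) (t_neq0 : t != 0) :
  ~ exists (l : nat) (G : nat -> {poly rat}),
      (0 < l)%N /\
      exists N : nat, forall n : nat, (N <= n)%N ->
        (lucas_atom_at n s t)%:~R =
          (G 0%N).[n%:R]
          + \sum_(1 <= j < l.+1) (G j).[n%:R] * (lucas_atom_at (n - j) s t)%:~R.
Proof.
case=> l [G [_ [N recP]]].
have [D D_neq0 [H HE]] := rat_polys_common_denom l.+1 G.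
have recZ n : (N <= n)%N -> D * lucas_atom_at n s t = (H 0%N).[n%:R]
    + \sum_(1 <= j < l.+1) (H j).[n%:R] * lucas_atom_at (n - j) s t.
  move=> le_Nn; apply: (@intr_inj rat); rewrite intrM recP // intrD [in RHS]rmorph_sum /=.
  have GE j : (j < l.+1)%N -> D%:~R * (G j).[n%:R] = (H j).[n%:R]%:~R :> rat.
    by move=> lt_jl; rewrite -hornerZ HE // horner_map_intr_nat.
  rewrite mulrDr GE // mulr_sumr; congr (_ + _); apply: eq_big_nat => j /andP[_ lt_jl].
  by rewrite mulrA GE // intrM.
(* A prime larger than |t D|, which is nonzero, divides neither t nor D. *)
have [p lt_p p_pr] := prime_above (absz (t * D)).
have [F [pF [a [b [sE tE]]]]] := exists_split_quadratic s t p_pr.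
have tD_neq0 : (t * D)%:~R != 0 :> F.
  rewrite [t * D]intEsign rmorphM rmorph_sign mulf_eq0 signr_eq0 /= -(dvdn_pcharf pF) gtnNdvd //.
  by rewrite absz_gt0 mulf_neq0.
have [tF_neq0 DF_neq0] : t%:~R != 0 :> F /\ D%:~R != 0 :> F.
  by move: tD_neq0; rewrite intrM mulf_eq0 negb_or => /andP.
have [a_neq0 b_neq0] : a != 0 /\ b != 0.
  by apply/andP; rewrite -negb_or -mulf_eq0 tE oppr_eq0.
have [m prim_z] : exists m, m.-primitive_root (a / b).
  by apply: exists_prim_root_order; rewrite mulf_neq0 ?invr_eq0.
pose u n : F := (lucas_atom_at n s t)%:~R.
have m_gt0 := prim_order_gt0 prim_z.
have u_eq0 n : (1 < n)%N -> (u n == 0) = root (map_poly intr 'Phi_n) (a / b).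
  move=> n_gt1; rewrite /u (lucas_atom_at_Cyclotomic sE tE b_neq0 n_gt1).
  by rewrite mulf_eq0 expf_eq0 (negPf b_neq0) andbF.
(* D is invertible in [F], so these are the reductions of the [G j]. *)
pose g j : {poly F} := D%:~R^-1 *: map_poly intr (H j).
have recF n : (N <= n)%N ->
    u n = (g 0%N).[n%:R] + \sum_(1 <= j < l.+1) (g j).[n%:R] * u (n - j)%N.
  move=> /recZ/(congr1 (intr : int -> F)); rewrite intrM intrD [X in _ + X]rmorph_sum /= => recE.
  apply: (mulfI DF_neq0); rewrite [LHS]recE mulrDr mulr_sumr.
  rewrite hornerZ horner_map_intr_nat mulVKf //; congr (_ + _); apply: eq_bigr => j _.
  by rewrite hornerZ horner_map_intr_nat -mulrA mulVKf // intrM.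
have [T T_gt0 [M perT]] := prec_eventually_periodic recF.
(* This choice makes p^(k+1) m larger than both M and T. *)
pose k := (M + T)%N; have p_gt1 := prime_gt1 p_pr.
have lt_kn : (k.+1 < p ^ k.+1 * m)%N.
  by rewrite (leq_trans (ltn_expl _ p_gt1)) // leq_pmulr.
have n_gt1 : (1 < p ^ k.+1 * m)%N by apply: leq_trans lt_kn.
have /eqP un0 : u (p ^ k.+1 * m)%N == 0 by rewrite u_eq0 // Cyclotomic_pchar_root.
have leM : (M <= p ^ k.+1 * m)%N.
  by apply: leq_trans (ltnW lt_kn); rewrite ltnW // ltnS leq_addr.
(* Periodicity carries the zero at p^(k+1) m to one at p^(k+1) m + T, which must therefore be some
   p^j m. *)
have := perT _ leM; rewrite un0 => /eqP; rewrite u_eq0 ?ltn_addr //.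
case/(root_Cyclotomic_pchar pF prim_z); first by rewrite addn_gt0 T_gt0 orbT.
move=> j jE.
have lt_kj : (k.+1 < j)%N.
  rewrite -(ltn_exp2l _ _ p_gt1) -(ltn_pmul2r m_gt0) -jE.
  by rewrite -[X in (X < _)%N]addn0 ltn_add2l.
(* As j > k + 1 and p >= 2, the next such index is at least twice p^(k+1) m, whereas the shift T is
   smaller than p^(k+1) m. *)
have : (2 * (p ^ k.+1 * m) <= p ^ k.+1 * m + T)%N.
  rewrite jE mulnA leq_pmul2r // (leq_trans _ (_ : p ^ k.+2 <= _)%N) //.
    by rewrite [in leqRHS]expnS leq_mul2r p_gt1 orbT.
  by rewrite leq_exp2l.
rewrite mul2n -addnn leq_add2l leqNgt (leq_ltn_trans _ lt_kn) //.
by rewrite ltnW // ltnS leq_addl.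
Qed.
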